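(* (a) There is a quantifier-free, parameter-free insertion query $\rho$ over the graph schema such that $(q_{\mathrm{Reach}},\{\mathrm{ins}_E(\bar p),\rho\})$ cannot be maintained in DynFO on ordered directed graphs by any dynamic program all of whose auxiliary relations, other than the (binary) query relation and the built-in linear order, are unary. (b) There is an $\mathrm{FO}[\exists^*]$-definable, parameter-free insertion query $\rho'$ such that the same statement holds for $(q_{\mathrm{Reach}},\{\mathrm{ins}_E(\bar p),\rho'\})$ even when restricted to acyclic directed graphs.
   Context: Framework. A replacement rule for a relation symbol $R$ is $R := \mu_R(\bar p;\bar x)$ with $\mu_R$ first-order; a replacement query $\rho(\bar p)$ is a set of such rules for distinct relations with a common parameter tuple $\bar p$ (parameter-free if $\bar p$ is empty; quantifier-free, resp. $\mathrm{FO}[\exists^*]$, if all formulas are quantifier-free, resp. existential). A change $\rho(\bar a)$ replaces each ruled relation $R$ by $\{\bar b:\mathcal D\models\mu_R(\bar a;\bar b)\}$. An insertion query has all $\mu_R$ of the form $R(\bar x)\lor\varphi_R$. $\mathrm{ins}_E(\bar p)$ is the single-edge insertion $E:=E(x,y)\lor (x,y)=\bar p$. A dynamic program operates on states of an input database and an auxiliary database over a fixed finite domain; for each allowed replacement query $\rho(\bar p)$ and auxiliary symbol $T$ it has an update formula $\varphi_T(\bar p;\bar x)$ over input and auxiliary schema, and after change $\rho(\bar a)$ the input is replaced by its image and $T$ becomes $\{\bar b:\text{old state}\models\varphi_T(\bar a,\bar b)\}$. It maintains $(q,\Delta)$ if an auxiliary relation $Q$ equals $q$ of the current input after every nonempty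 sequence of changes from $\Delta$ starting from the empty input and empty auxiliary database. DynFO: first-order update formulas. For a restricted class of inputs (acyclic graphs), only change sequences keeping the input in the class are considered. $q_{\mathrm{Reach}}$ maps a directed graph to the set of pairs $(u,v)$ with a directed path from $u$ to $v$. An ordered directed graph has, in addition to $E$, a built-in linear order on its nodes which is never changed. *)

(* Defs.v *)
From HB Require Import structures.
From mathcomp Require Import all_boot.
Set Implicit Arguments. Unset Strict Implicit. Unset Printing Implicit Defensive.

Section FOSyntax.
Variables (S : Type) (ar : S -> nat).

Inductive fo : Type :=
| FTrue
| FFalse
| FAtom (R : S) (args : (ar R).-tuple nat)
| FEq (x y : nat)
| FNot (f : fo)
| FAnd (f g : fo)
| FOr (f g : fo)
| FEx (x : nat) (f : fo)
| FAll (x : nat) (f : fo).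

Fixpoint qf (f : fo) : bool :=
  match f with
  | FEx _ _ | FAll _ _ => false
  | FNot g => qf g
  | FAnd g h | FOr g h => qf g && qf h
  | _ => true
  end.

Fixpoint exfo (f : fo) : bool :=
  match f with
  | FAll _ _ => false
  | FEx _ g => exfo g
  | FNot g => qf g
  | FAnd g h | FOr g h => exfo g && exfo h
  | _ => true
  end.

Fixpoint fvars (f : fo) : seq nat :=
  match f with
  | FTrue | FFalse => [::]
  | FAtom _ args => tval args
  | FEq x y => [:: x; y]
  | FNot g => fvars g
  | FAnd g h | FOr g h => fvars g ++ fvars h
  | FEx x g | FAll x g => [seq i <- fvars g | i != x]
  end.

Definition wf (m : nat) (f : fo) : bool := all (fun i => i < m) (fvars f).

Variable D : finType.
Definition interp := forall R : S, (ar R).-tuple D -> bool.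
Definition upd (e : nat -> D) (x : nat) (d : D) : nat -> D :=
  fun i => if i == x then d else e i.

Fixpoint sat (I : interp) (e : nat -> D) (f : fo) : bool :=
  match f with
  | FTrue => true
  | FFalse => false
  | FAtom R args => I R (map_tuple e args)
  | FEq x y => e x == e y
  | FNot g => ~~ sat I e g
  | FAnd g h => sat I e g && sat I e h
  | FOr g h => sat I e g || sat I e h
  | FEx x g => [exists d : D, sat I (upd e x d) g]
  | FAll x g => [forall d : D, sat I (upd e x d) g]
  end.
End FOSyntax.

(* Environment assigning the i-th element of s to variable i
   (domain is 'I_n.+1, nonempty; default irrelevant for wf formulas). *)
Definition env_of (n : nat) (s : seq 'I_n.+1) : nat -> 'I_n.+1 :=
  fun i => nth ord0 s i.

Inductive gsym := GE.
Definition gar (_ : gsym) : nat := 2.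

Definition ginterp (D : finType) (E : 2.-tuple D -> bool) : interp gar D :=
  fun R => match R return (gar R).-tuple D -> bool with GE => E end.

(* A parameter-free insertion query over the graph schema:
   rho = { E := E(x0,x1) \/ phi(x0,x1) } *)
Definition rho_formula (phi : fo gar) : fo gar :=
  FOr (@FAtom gsym gar GE [tuple 0; 1]) phi.

(* Schema of a dynamic program with k unary auxiliary relations:
   input E, built-in order Lt, query relation Q (binary), unary U_i. *)
Inductive psym (k : nat) := PE | PLt | PQ | PU of 'I_k.
Definition par (k : nat) (R : psym k) : nat :=
  match R with PE | PLt | PQ => 2 | PU _ => 1 end.

Inductive asym (k : nat) := AQ | AU of 'I_k.
Definition aar (k : nat) (T : asym k) : nat :=
  match T with AQ => 2 | AU _ => 1 end.

Record dynprog (k : nat) := DynProg {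
  upd_ins : asym k -> fo (@par k);  (* phi_T(p1,p2; x): vars 0,1 = p, 2.. = x *)
  upd_rho : asym k -> fo (@par k)   (* phi_T(x): vars 0.. = x *)
}.

Definition dynprog_wf (k : nat) (P : dynprog k) : Prop :=
  forall T : asym k, wf (2 + aar T) (upd_ins P T) && wf (aar T) (upd_rho P T).

Record state (n k : nat) := State {
  stE : 2.-tuple 'I_n.+1 -> bool;
  stA : forall T : asym k, (aar T).-tuple 'I_n.+1 -> bool
}.

Definition init_state (n k : nat) : state n k :=
  State (fun _ => false) (fun _ _ => false).

Definition pinterp (n k : nat) (s : state n k) : interp (@par k) 'I_n.+1 :=
  fun R => match R return (par R).-tuple 'I_n.+1 -> bool with
  | PE => stE s
  | PLt => fun t => (thead t < tnth t ord_max)%N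
  | PQ => @stA n k s (@AQ k)
  | PU i => @stA n k s (AU i)
  end.

Inductive change (n : nat) := CIns (a b : 'I_n.+1) | CRho.

Definition step (k : nat) (rho : fo gar) (P : dynprog k) (n : nat)
    (s : state n k) (c : change n) : state n k :=
  match c with
  | CIns a b =>
      State (fun t => stE s t || (t == [tuple a; b]))
            (fun T t => sat (pinterp s) (env_of [:: a, b & tval t]) (upd_ins P T))
  | CRho =>
      State (fun t => sat (ginterp (stE s)) (env_of (tval t)) (rho_formula rho))
            (fun T t => sat (pinterp s) (env_of (tval t)) (upd_rho P T))
  end.

Definition run (k : nat) (rho : fo gar) (P : dynprog k) (n : nat)
    (cs : seq (change n)) : state n k :=
  foldl (@step k rho P n) (init_state n k) cs.

Definition edges (D : finType) (E : 2.-tuple D -> bool) : rel D :=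
  fun u v => E [tuple u; v].

Definition Q_correct (n k : nat) (s : state n k) : Prop :=
  forall u v : 'I_n.+1, @stA n k s (@AQ k) [tuple u; v] = connect (edges (stE s)) u v.

Definition acyclic (D : finType) (E : 2.-tuple D -> bool) : Prop :=
  forall u v : D, E [tuple u; v] -> ~~ connect (edges E) v u.

Definition maintains (k : nat) (P : dynprog k) (rho : fo gar) : Prop :=
  forall (n : nat) (cs : seq (change n)), (0 < size cs)%N ->
    Q_correct (run rho P cs).

Definition maintains_acyclic (k : nat) (P : dynprog k) (rho : fo gar) : Prop :=
  forall (n : nat) (cs : seq (change n)), (0 < size cs)%N ->
    (forall i, i <= size cs -> acyclic (stE (run rho P (take i cs)))) ->
    Q_correct (run rho P cs).

(* Main.v *)
(* Nodes form a grid of m rows and 3L+1 columns, ordered column by column, and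
   every row is a path with edges oriented so that no directed path is longer
   than 2; reachability is then a local relation. Applying rho connects the first
   node of each row to the last one, without connecting different rows.
   Whatever the unary relations are, they turn the ordered set of rows into a word
   over an alphabet (colourings of a row) that depends on L but not on m. For m
   larger than the number of rank-r types of positions in such words, two rows
   i <> j have the same type. Then Duplicator wins the r-round game from
   (first of row i, last of row i) to (first of row i, last of row j): she keeps
   the column of each pebble, copies its row on the left side, and on the right
   side plays the game on words; the border between both sides is fixed
   progressively, so that L > 2^r columns suffice. Hence no update formula of
   rank r separates the two pairs. *)
Require Import Defs.
From mathcomp Require Import all_boot.
From mathcomp Require Import zify.
Set Implicit Arguments. Unset Strict Implicit. Unset Printing Implicit Defensive.

(** * Tuples of length one and two *)

Section Tuples.
Variables (A B : Type).

Lemma tuple1_eta (t : 1.-tuple A) : exists x, t = [tuple x].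
Proof. by case/tupleP: t => x t; exists x; rewrite (tuple0 t); apply: val_inj. Qed.

Lemma tuple2_eta (t : 2.-tuple A) : exists x y, t = [tuple x; y].
Proof.
by case/tupleP: t => x t; have [y ->] := tuple1_eta t; exists x, y; apply: val_inj.
Qed.

Lemma map_tuple1 (g : A -> B) x : map_tuple g [tuple x] = [tuple g x].
Proof. exact: val_inj. Qed.

Lemma map_tuple2 (g : A -> B) x y : map_tuple g [tuple x; y] = [tuple g x; g y].
Proof. exact: val_inj. Qed.

End Tuples.

(** * Quantifier rank and variables *)

Section Syntax.
Variables (S : Type) (ar : S -> nat).

Fixpoint qrank (f : fo ar) : nat :=
  match f with
  | FNot g => qrank g
  | FAnd g h | FOr g h => maxn (qrank g) (qrank h)
  | FEx _ g | FAll _ g => (qrank g).+1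
  | _ => 0
  end.

(** Bound variables count too: each variable is a pebble, and a quantifier moves the pebble of its
    variable. *)
Fixpoint var_bound (f : fo ar) : nat :=
  match f with
  | FTrue | FFalse => 0
  | FAtom _ args => \max_(i <- args) i.+1
  | FEq x y => maxn x.+1 y.+1
  | FNot g => var_bound g
  | FAnd g h | FOr g h => maxn (var_bound g) (var_bound h)
  | FEx x g | FAll x g => maxn x.+1 (var_bound g)
  end.

End Syntax.

(** * Types of positions in words *)

Section RowTypes.
Variables (N : nat) (Sigma : finType).

Definition atomic_type : finType :=
  ({ffun 'I_N -> Sigma} * {ffun 'I_N * 'I_N -> bool})%type.

(** Independent of the word length, so the number of types is known before [m] is chosen. *)
Fixpoint rank_type (r : nat) : finType :=
  match r with
  | 0 => atomic_type
  | r'.+1 => (atomic_type * {ffun 'I_N -> {set rank_type r'}})%type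
  end.

Variables (m : nat) (w : 'I_m -> Sigma).

Definition atp (rho : nat -> 'I_m) : atomic_type :=
  ([ffun x : 'I_N => w (rho x)], [ffun p : 'I_N * 'I_N => rho p.1 < rho p.2]).

(* Pebble game types: a move reassigns one of the [N] variables. *)
Fixpoint rtp (r : nat) (rho : nat -> 'I_m) : rank_type r :=
  match r with
  | 0 => atp rho
  | r'.+1 =>
      (atp rho,
       [ffun x : 'I_N => [set rtp r' (upd rho x a) | a : 'I_m]])
  end.

Lemma rtp_atp r rho rho' : rtp r rho = rtp r rho' -> atp rho = atp rho'.
Proof. by case: r => [|r] //= /(congr1 fst). Qed.

Lemma rtp_letter r rho rho' x :
  rtp r rho = rtp r rho' -> x < N -> w (rho x) = w (rho' x).
Proof.
move=> /rtp_atp /(congr1 fst) /ffunP e ltx.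
by have := e (Ordinal ltx); rewrite !ffunE.
Qed.

Lemma rtp_lt r rho rho' x y :
  rtp r rho = rtp r rho' -> x < N -> y < N ->
  (rho x < rho y) = (rho' x < rho' y).
Proof.
move=> /rtp_atp /(congr1 snd) /ffunP e ltx lty.
by have := e (Ordinal ltx, Ordinal lty); rewrite !ffunE.
Qed.

(** Atomic types record only letters and the order; the order decides equality by trichotomy. *)
Lemma rtp_eq r rho rho' x y :
  rtp r rho = rtp r rho' -> x < N -> y < N ->
  (rho x == rho y) = (rho' x == rho' y).
Proof.
move=> e ltx lty; rewrite -[LHS](inj_eq (@ord_inj m)) -[RHS](inj_eq (@ord_inj m)).
have := rtp_lt e ltx lty; have := rtp_lt e lty ltx.
by case: (ltngtP (rho x) (rho y)); case: (ltngtP (rho' x) (rho' y)).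
Qed.

Lemma rtp_move r rho rho' x a :
  rtp r.+1 rho = rtp r.+1 rho' -> x < N ->
  exists b, rtp r (upd rho x a) = rtp r (upd rho' x b).
Proof.
move=> /= /(congr1 snd) /ffunP e ltx; have := e (Ordinal ltx); rewrite !ffunE /= => es.
have : rtp r (upd rho x a) \in [set rtp r (upd rho x a) | a : 'I_m].
  exact: imset_f.
by rewrite es => /imsetP [b _ eb]; exists b.
Qed.

End RowTypes.

(** * The grid, the game on it and the zigzag *)

Section Grid.
Variables (m' c' : nat).
Local Notation m := m'.+1.
Local Notation C := c'.+1.

Definition grid_max : nat := (m * C).-1.
Local Notation D := 'I_grid_max.+1.

Definition row (v : D) : nat := v %% m.
Definition col (v : D) : nat := v %/ m.
Definition node (a c : nat) : D := inord (c * m + a).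

Lemma grid_maxS : grid_max.+1 = m * C.
Proof. by rewrite /grid_max; lia. Qed.

Lemma row_lt v : row v < m. Proof. exact: ltn_pmod. Qed.

Lemma col_lt v : col v < C.
Proof. by rewrite /col ltn_divLR // mulnC -grid_maxS. Qed.

Lemma node_val a c : a < m -> c < C -> node a c = c * m + a :> nat.
Proof. by move=> lta ltc; rewrite inordK // grid_maxS; nia. Qed.

Lemma row_node a c : a < m -> c < C -> row (node a c) = a.
Proof. by move=> lta ltc; rewrite /row node_val // modnMDl modn_small. Qed.

Lemma col_node a c : a < m -> c < C -> col (node a c) = c.
Proof.
by move=> lta ltc; rewrite /col node_val // divnMDl // divn_small // addn0.
Qed.

Lemma node_row_col v : node (row v) (col v) = v.
Proof.
by apply/val_inj; rewrite /= node_val ?row_lt ?col_lt // /row /col -divn_eq.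
Qed.

Lemma grid_eq (u v : D) : (u == v) = (row u == row v) && (col u == col v).
Proof.
apply/eqP/andP => [-> // | [/eqP er /eqP ec]].
by rewrite -(node_row_col u) -(node_row_col v) er ec.
Qed.

Lemma grid_lt (u v : D) :
  (u < v) = (col u < col v) || ((col u == col v) && (row u < row v)).
Proof.
have := divn_eq u m; have := divn_eq v m.
rewrite -/(row u) -/(col u) -/(row v) -/(col v).
by have := row_lt u; have := row_lt v; nia.
Qed.

Section Game.
Variables (k : nat) (I : interp (@par k) D) (eE eQ : rel nat).
Hypothesis PE_grid : forall u v,
  @I (@PE k) [tuple u; v] = (row u == row v) && eE (col u) (col v).
Hypothesis PQ_grid : forall u v,
  @I (@PQ k) [tuple u; v] = (row u == row v) && eQ (col u) (col v).
Hypothesis PLt_grid : forall u v, @I (@PLt k) [tuple u; v] = (u < v).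
Hypothesis eE_near : forall x y, eE x y -> (x <= y + 2) && (y <= x + 2).
Hypothesis eQ_near : forall x y, eQ x y -> (x <= y + 2) && (y <= x + 2).

(** The colours of a whole row form one letter, so that a row is one position of a word. *)
Definition letter (a : 'I_m) : {ffun 'I_C * 'I_k -> bool} :=
  [ffun p : 'I_C * 'I_k => @I (PU p.2) [tuple node a p.1]].

Variable N : nat.
Local Notation tp := (rtp N letter).

(* [c] is the border. Only the variables on its right are tracked by [rho] and
   [rho']; the values of the others there are arbitrary. *)
Definition similar (r : nat) (e e' : nat -> D) : Prop :=
  exists (c : nat) (rho rho' : nat -> 'I_m),
  [/\ 2 ^ r.+1 <= c, tp r rho = tp r rho' &
   forall x, x < N -> col (e x) = col (e' x) /\
   ((col (e x) + 2 ^ r.+1 <= c /\ row (e x) = row (e' x)) \/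
    [/\ c + 2 ^ r.+1 <= col (e x), row (e x) = rho x & row (e' x) = rho' x])].

Lemma similar_sym r e e' : similar r e e' -> similar r e' e.
Proof.
case=> c [rho [rho' [lec etp H]]]; exists c, rho', rho; split=> // x ltx.
have [-> H'] := H x ltx; split=> //.
by case: H' => [[? ?]|[? ? ?]]; [left | right].
Qed.

(** The border moves away from [d] by half of the old margin [2 ^ r.+2], so all pebbles keep the
    margin [2 ^ r.+1]. *)
Lemma similar_step r e e' x d : similar r.+1 e e' -> x < N ->
  exists d', similar r (upd e x d) (upd e' x d').
Proof.
case=> c [rho [rho' [lec etp H]]] ltx.
have e2 : 2 ^ r.+2 = 2 * 2 ^ r.+1 by rewrite expnS.
have [cd|cd] := leqP (col d) c.
  (* [d] is on the left and is copied; the idle move of pebble [x] in the word only lowers the rank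
     of the types. *)
  have [b eb] := rtp_move (rho x) etp ltx.
  exists d, (c + 2 ^ r.+1), (upd rho x (rho x)), (upd rho' x b).
  split=> [|//|y lty]; first by lia.
  have [ecol H'] := H y lty.
  rewrite /upd; case: eqP => _; first by split=> //; left; split=> //; lia.
  by split=> //; case: H' => [[? ?]|[? ? ?]]; [left | right]; split=> //; lia.
(* [d] is on the right: its column is kept and its row is answered in the word. As [2 ^ r.+2 <= c],
   the new border [c - 2 ^ r.+1] is not truncated. *)
have [b eb] := rtp_move (Ordinal (row_lt d)) etp ltx.
exists (node b (col d)), (c - 2 ^ r.+1), (upd rho x (Ordinal (row_lt d))), (upd rho' x b).
split=> [|//|y lty]; first by lia.
have [ecol H'] := H y lty.
rewrite /upd; case: eqP => _.
  rewrite col_node ?row_node ?col_lt //; split=> //.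
  by right; split=> //; lia.
by split=> //; case: H' => [[? ?]|[? ? ?]]; [left | right]; split=> //; lia.
Qed.

(** Pebbles on different sides are at least 4 columns apart, too far for [R]. On one side, rows are
    copied or compared through equal types. *)
Lemma similar_near (R : rel nat) r e e' x y :
  (forall i j, R i j -> (i <= j + 2) && (j <= i + 2)) ->
  similar r e e' -> x < N -> y < N ->
  (row (e x) == row (e y)) && R (col (e x)) (col (e y)) =
  (row (e' x) == row (e' y)) && R (col (e' x)) (col (e' y)).
Proof.
move=> R_near [c [rho [rho' [lec etp H]]]] ltx lty.
have gt1 : 2 <= 2 ^ r.+1 by rewrite expnS; have := expn_gt0 2 r; lia.
have [<- Hx] := H x ltx; have [<- Hy] := H y lty.
case Rxy : (R _ _); rewrite ?andbF // !andbT.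
have {Rxy} := R_near _ _ Rxy.
case: Hx => [[? ->]|[? -> ->]]; case: Hy => [[? ->]|[? -> ->]] //; try lia.
by move=> _; exact: (rtp_eq etp).
Qed.

(** Rows matter only within a common column, and two pebbles in one column are on the same side. *)
Lemma similar_lt r e e' x y : similar r e e' -> x < N -> y < N ->
  (e x < e y) = (e' x < e' y).
Proof.
move=> [c [rho [rho' [lec etp H]]]] ltx lty.
have gt1 : 2 <= 2 ^ r.+1 by rewrite expnS; have := expn_gt0 2 r; lia.
rewrite !grid_lt.
have [<- Hx] := H x ltx; have [<- Hy] := H y lty.
case: ltngtP => //= ecol.
case: Hx => [[? ->]|[? -> ->]]; case: Hy => [[? ->]|[? -> ->]] //; try lia.
exact: (rtp_lt etp).
Qed.

Lemma similar_eq r e e' x y : similar r e e' -> x < N -> y < N ->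
  (e x == e y) = (e' x == e' y).
Proof.
move=> sim ltx lty; rewrite !grid_eq.
by apply: (similar_near (R := fun i j => i == j) _ sim) => // i j /eqP ->; lia.
Qed.

Lemma similar_unary r e e' x i : similar r e e' -> x < N ->
  @I (PU i) [tuple e x] = @I (PU i) [tuple e' x].
Proof.
move=> [c [rho [rho' [_ etp H]]]] ltx.
have [ecol Hx] := H x ltx.
rewrite -(node_row_col (e x)) -(node_row_col (e' x)) -ecol.
case: Hx => [[_ ->] //|[_ -> ->]].
have /ffunP /(_ (Ordinal (col_lt (e x)), i)) := rtp_letter etp ltx.
by rewrite !ffunE.
Qed.

Lemma similar_sat (f : fo (@par k)) r e e' :
  var_bound f <= N -> qrank f <= r -> similar r e e' -> sat I e f = sat I e' f.
Proof.
elim: f r e e' => //=.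
- move=> R args r e e' vb _ sim.
  have ltN x : x \in tval args -> x < N.
    by move=> xin; apply: leq_trans vb; apply: (leq_bigmax_seq (F := succn)).
  case: R args ltN {vb} => [|||i] /= args;
    first [ have [x [y ->]] := tuple2_eta args => ltN; rewrite !map_tuple2
          | have [x ->] := tuple1_eta args => ltN; rewrite !map_tuple1 ].
  + rewrite !PE_grid; apply: (similar_near _ sim) => //;
      by apply: ltN; rewrite !inE eqxx ?orbT.
  + rewrite !PLt_grid; apply: (similar_lt sim) => //;
      by apply: ltN; rewrite !inE eqxx ?orbT.
  + rewrite !PQ_grid; apply: (similar_near _ sim) => //;
      by apply: ltN; rewrite !inE eqxx ?orbT.
  + by apply: (similar_unary _ sim); apply: ltN; rewrite inE.
- by move=> x y r e e'; rewrite geq_max => /andP [ltx lty] _ /similar_eq ->.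
- by move=> g IH r e e' vb qr sim; rewrite (IH r e e').
- move=> g IHg h IHh r e e'; rewrite !geq_max => /andP [vg vh] /andP [qg qh] sim.
  by rewrite (IHg r e e') // (IHh r e e').
- move=> g IHg h IHh r e e'; rewrite !geq_max => /andP [vg vh] /andP [qg qh] sim.
  by rewrite (IHg r e e') // (IHh r e e').
- move=> x g IH [//|r] e e'; rewrite geq_max => /andP [ltx vg] qr sim.
  apply/existsP/existsP => -[d Hd].
    have [d' sim'] := similar_step d sim ltx.
    by exists d'; rewrite -(IH r _ _ _ _ sim').
  have [d' sim'] := similar_step d (similar_sym sim) ltx.
  by exists d'; rewrite -(IH r _ _ _ _ sim').
- move=> x g IH [//|r] e e'; rewrite geq_max => /andP [ltx vg] qr sim.
  apply/forallP/forallP => H d.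
    have [d' sim'] := similar_step d (similar_sym sim) ltx.
    by rewrite (IH r _ _ _ _ sim').
  have [d' sim'] := similar_step d sim ltx.
  by rewrite (IH r _ _ _ _ sim').
Qed.

Lemma swapped_ends_sat (f : fo (@par k)) (i j : 'I_m) :
  var_bound f <= N -> 2 * 2 ^ (qrank f).+1 <= c' ->
  tp (qrank f) (fun=> i) = tp (qrank f) (fun=> j) ->
  sat I (env_of [:: node i 0; node i c']) f =
  sat I (env_of [:: node i 0; node j c']) f.
Proof.
move=> vb large etp; apply: similar_sat vb (leqnn _) _.
(* This border has the required margin from column 0 and, by the bound on [c'], from the last
   column. *)
exists (2 ^ (qrank f).+1), (fun=> i), (fun=> j); split=> // -[|[|x]] _ /=.
- by rewrite col_node //; split=> //; left.
- by rewrite !col_node // !row_node //; split=> //; right; split=> //; lia.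
(* The other variables take the default [ord0], which lies in column 0 and hence on the left. *)
- rewrite /env_of /= nth_nil; split=> //; left.
  by rewrite /col div0n.
Qed.

End Game.

(* Each row carries the zigzag 0 <- 1 -> 2 -> 3 <- 4 -> 5 -> 6 <- ... *)
Definition zig (x y : nat) : bool :=
  ((x %% 3 == 1) && ((y.+1 == x) || (y == x.+1))) ||
  ((x %% 3 == 2) && (y == x.+1)).

(** Reachability along a row: the only edges that compose are 1 -> 2 -> 3, up to shifts by 3. *)
Definition zigs (x y : nat) : bool :=
  [|| x == y, zig x y | (x %% 3 == 1) && (y == x.+2)].

Definition zigzag : rel D := fun u v => (row u == row v) && zig (col u) (col v).

Lemma zig_near x y : zig x y -> (x <= y + 2) && (y <= x + 2).
Proof. by rewrite /zig; lia. Qed.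

Lemma zigs_near x y : zigs x y -> (x <= y + 2) && (y <= x + 2).
Proof. by rewrite /zigs /zig; lia. Qed.

Lemma zigs_zig x y z : zigs x y -> zig y z -> zigs x z.
Proof. by rewrite /zigs /zig; lia. Qed.

Lemma zigzag_node a x y : a < m -> x < C -> y < C ->
  zigzag (node a x) (node a y) = zig x y.
Proof. by move=> lta ltx lty; rewrite /zigzag !row_node ?col_node ?eqxx. Qed.

Lemma connect_zigzag u v :
  connect zigzag u v = (row u == row v) && zigs (col u) (col v).
Proof.
apply/idP/idP => [/connectP [p pth ->] | /andP [/eqP er]].
  elim/last_ind: p pth => [|p v' IH] /=; first by rewrite /zigs !eqxx.
  rewrite rcons_path last_rcons => /andP [/IH /andP [/eqP -> H]].
  by case/andP => -> /=; apply: zigs_zig H.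
case/or3P => [ec|z|/andP [u1 /eqP ec]].
- by rewrite (_ : u = v) ?connect0 //; apply/eqP; rewrite grid_eq er eqxx.
- by apply: connect1; rewrite /zigzag er eqxx.
have ltC : (col u).+1 < C by have := col_lt v; lia.
apply: (@connect_trans _ _ (node (row u) (col u).+1)); apply: connect1.
  by rewrite /zigzag row_node ?col_node ?row_lt // eqxx /zig u1 eqxx orbT.
rewrite /zigzag row_node ?col_node ?row_lt // er eqxx ec /zig eqxx.
by apply/orP; right; lia.
Qed.

End Grid.

(** * Runs of insertions *)

Section Runs.
Variables (k : nat) (phi : fo gar) (P : dynprog k) (n : nat).
Local Notation D := 'I_n.+1.

Definition insertions (es : seq (D * D)) : seq (change n) :=
  [seq CIns p.1 p.2 | p <- es].

Lemma run_insertions es u v :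
  stE (run phi P (insertions es)) [tuple u; v] = ((u, v) \in es).
Proof.
elim/last_ind: es => [//|es p IH]; rewrite /insertions map_rcons /run.
rewrite foldl_rcons /= -/(run phi P _) IH mem_rcons inE orbC.
by congr (_ || _); case: p => a b; rewrite /= -val_eqE /= !eqseq_cons andbT.
Qed.

Lemma run_rho cs : run phi P (rcons cs (CRho n)) = step phi P (run phi P cs) (CRho n).
Proof. by rewrite /run foldl_rcons. Qed.

End Runs.

Lemma connect_invariant (T : finType) (A : eqType) (e : rel T) (h : T -> A) :
  (forall u v, e u v -> h u = h v) -> forall u v, connect e u v -> h u = h v.
Proof.
move=> He u v /connectP [p pth ->]; elim: p u pth => //= w p IH u /andP [/He -> ].
exact: IH.
Qed.

Lemma acyclic_potential (D : finType) (E : 2.-tuple D -> bool) (h : D -> nat) :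
  (forall u v, E [tuple u; v] -> h u < h v) -> acyclic E.
Proof.
move=> hE u v uv; apply/negP => /connectP [p pth eu].
have : h v <= h u.
  rewrite eu; elim: p v pth {uv eu} => //= w p IH v /andP [/hE lt /IH].
  exact: leq_trans (ltnW lt).
by rewrite leqNgt (hE _ _ uv).
Qed.

(** * Applying the query to the zigzag *)

Section ZigzagRun.
Variables (phi : fo gar) (k : nat) (P : dynprog k) (m' L : nat).
Local Notation n := (grid_max m' (3 * L)).
Local Notation D := 'I_n.+1.

Definition zigzag_edges : seq (D * D) :=
  [seq p <- enum {: D * D} | zigzag p.1 p.2].

Definition build : seq (change n) := insertions zigzag_edges.

Lemma run_build u v : stE (run phi P build) [tuple u; v] = zigzag u v.
Proof. by rewrite run_insertions mem_filter mem_enum andbT. Qed.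

(** Correctness is demanded only after a nonempty sequence of changes. *)
Lemma size_build : 0 < L -> 0 < size build.
Proof.
move=> L0; rewrite size_map -has_predT; apply/hasP.
exists (@node m' (3 * L) 0 1, @node m' (3 * L) 0 0) => //.
by rewrite mem_filter mem_enum /= zigzag_node //; lia.
Qed.

Lemma run_build_rho u v :
  stE (run phi P (rcons build (CRho n))) [tuple u; v] =
  zigzag u v || sat (ginterp (stE (run phi P build))) (env_of [:: u; v]) phi.
Proof.
rewrite run_rho /= -run_build; congr (stE _ _ || _); exact: val_inj.
Qed.

End ZigzagRun.

(** [R] stands for the reachability after the query. It joins the ends of each row; were it defined
    by [F], it would also join ends of two distinct rows of equal type. *)
Lemma rho_update_fails (k : nat) (F : fo (@par k)) : exists m' L, 0 < L /\
  forall s : state (grid_max m' (3 * L)) k,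
  (forall u v, stE s [tuple u; v] = zigzag u v) -> Q_correct s ->
  forall R : rel 'I_(grid_max m' (3 * L)).+1,
  (forall u v, R u v -> row u = row v) ->
  (forall a, a < m'.+1 -> R (node m' (3 * L) a 0) (node m' (3 * L) a (3 * L))) ->
  ~ (forall u v, sat (pinterp s) (env_of [:: u; v]) F = R u v).
Proof.
set L := 2 ^ (qrank F).+1.
set T := rank_type (var_bound F) {ffun 'I_(3 * L).+1 * 'I_k -> bool} (qrank F).
(* This gives [#|T|.+1] rows, one more than there are types. *)
exists #|T|, L; split=> [|s sE sQ R Rrow Rpath FR]; first by rewrite expn_gt0.
pose m := #|T|.+1.
pose tp (i : 'I_m) : T :=
  rtp (var_bound F) (letter (pinterp s)) (qrank F) (fun=> i).
have /injectivePn [i [j neq_ij etp]] : ~~ injectiveb tp.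
  apply/negP => /injectiveP /leq_card.
  by rewrite card_ord ltnn.
have := @swapped_ends_sat _ _ k (pinterp s) zig zigs _ _ _ zig_near zigs_near
  (var_bound F) F i j (leqnn _) _ etp.
rewrite !FR Rpath // => swap.
have /Rrow : R (node #|T| (3 * L) i 0) (node #|T| (3 * L) j (3 * L)).
  apply/esym/swap => [u v|u v|//|]; first exact: sE.
  - rewrite /= sQ -connect_zigzag; apply: eq_connect => x y; exact: sE.
  - by rewrite /L leq_mul2r; lia.
rewrite !row_node // => eij.
by move: neq_ij; rewrite -val_eqE /= eij eqxx.
Qed.

(** The update formula of [AQ] is evaluated in [s], where edges and, by correctness, the query
    relation are local; correctness of [s'] would make it define the new reachability. *)
Lemma rho_not_maintained (phi : fo gar) (k : nat) (P : dynprog k) :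
  exists m' L, 0 < L /\
  let s := run phi P (build m' L) in
  let s' := run phi P (rcons (build m' L) (CRho _)) in
  (forall u v, edges (stE s') u v -> row u = row v) ->
  (forall a, a < m'.+1 ->
     connect (edges (stE s')) (node m' (3 * L) a 0) (node m' (3 * L) a (3 * L))) ->
  Q_correct s -> ~ Q_correct s'.
Proof.
have [m' [L [L0 H]]] := rho_update_fails (upd_rho P (@AQ k)).
exists m', L; split=> // s s' Hrow Hpath sQ s'Q.
apply: (H s _ sQ _ (connect_invariant Hrow) Hpath); first exact: run_build.
by move=> u v; rewrite -s'Q /s' run_rho.
Qed.

(** * The two insertion queries *)

Definition reversal : fo gar := @FAtom gsym gar GE [tuple 1; 0].

(** Adds u -> v if u <- z -> w -> v. On the zigzag the only new edges go from column 3x to column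
    3x+3 of a row. *)
Definition fork : fo gar :=
  FEx 2 (FEx 3 (FAnd (@FAtom gsym gar GE [tuple 2; 0])
    (FAnd (@FAtom gsym gar GE [tuple 2; 3]) (@FAtom gsym gar GE [tuple 3; 1])))).

Lemma sat_reversal n (E : 2.-tuple 'I_n.+1 -> bool) u v :
  sat (ginterp E) (env_of [:: u; v]) reversal = E [tuple v; u].
Proof. by rewrite /=; congr E; apply: val_inj. Qed.

Lemma sat_fork n (E : 2.-tuple 'I_n.+1 -> bool) u v :
  sat (ginterp E) (env_of [:: u; v]) fork =
  [exists z, exists w, [&& E [tuple z; u], E [tuple z; w] & E [tuple w; v]]].
Proof.
rewrite /=; apply: eq_existsb => z; apply: eq_existsb => w.
by congr [&& E _, E _ & E _]; apply: val_inj.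
Qed.

(** With reversed edges each row can be walked both ways, which joins its ends. This creates
    2-cycles, so the acyclic case takes another query. *)
Lemma reversal_not_maintained k (P : dynprog k) : ~ maintains P reversal.
Proof.
have [m' [L [L0 H]]] := rho_not_maintained reversal P.
move=> mP; apply: H; last first.
- by apply: mP; rewrite size_rcons.
- by apply: mP; apply: size_build.
- move=> a lta.
  suff path x : x < (3 * L).+1 ->
      connect (edges (stE (run reversal P (rcons (build m' L) (CRho _)))))
        (node m' (3 * L) a 0) (node m' (3 * L) a x) by exact: path.
  elim: x => [|x IH] ltx; first exact: connect0.
  apply: connect_trans (IH (ltnW ltx)) (connect1 _).
  rewrite /edges run_build_rho sat_reversal run_build.
  by rewrite !zigzag_node // /zig; lia.
- move=> u v; rewrite /edges run_build_rho sat_reversal run_build.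
  by case/orP => /andP [/eqP].
Qed.

(* Sources 1 mod 3, then 2 mod 3, then the columns divisible by 3, which
   [fork] links into a path. *)
Definition potential (x : nat) : nat := if x %% 3 == 0 then x.+2 else (x %% 3).-1.

Lemma zig_potential x y : zig x y -> potential x < potential y.
Proof. by rewrite /zig /potential; do 2!case: ifP; lia. Qed.

Lemma zig_fork x y z w : zig z x -> zig z w -> zig w y -> potential x < potential y.
Proof. by rewrite /zig /potential; do 2!case: ifP; lia. Qed.

Lemma fork_edge k (P : dynprog k) m' L u v :
  edges (stE (run fork P (rcons (build m' L) (CRho _)))) u v ->
  row u = row v /\ potential (col u) < potential (col v).
Proof.
rewrite /edges run_build_rho sat_fork.
case/orP => [/andP [/eqP -> /zig_potential] //|].
case/existsP => z /existsP [w]; rewrite !run_build.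
case/and3P => /andP [/eqP <- zu] /andP [/eqP -> zw] /andP [/eqP -> wv].
by split=> //; apply: zig_fork zu zw wv.
Qed.

Lemma fork_not_maintained k (P : dynprog k) : ~ maintains_acyclic P fork.
Proof.
have [m' [L [L0 H]]] := rho_not_maintained fork P.
move=> mP.
(* A prefix of [build] inserts zigzag edges only, and the potential increases along these. *)
have acyc i : acyclic (stE (run fork P (take i (build m' L)))).
  rewrite /build /insertions -map_take.
  apply: (@acyclic_potential _ _ (fun v => potential (col v))) => u v.
  rewrite run_insertions => /mem_take; rewrite mem_filter => /andP [/andP [_]].
  by move=> /zig_potential.
apply: H; last first.
- apply: mP => [|i]; first by rewrite size_rcons.
  rewrite size_rcons leq_eqVlt ltnS => /orP [/eqP ->|lei].
    rewrite -(size_rcons _ (CRho _)) take_size.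
    apply: (@acyclic_potential _ _ (fun v => potential (col v))) => u v.
    by case/fork_edge.
  by rewrite -cats1 takel_cat.
- by apply: mP => //; apply: size_build.
- move=> a lta.
  suff path x : x <= L ->
      connect (edges (stE (run fork P (rcons (build m' L) (CRho _)))))
        (node m' (3 * L) a 0) (node m' (3 * L) a (3 * x)) by exact: path.
  elim: x => [|x IH] lex; first exact: connect0.
  apply: connect_trans (IH (ltnW lex)) (connect1 _).
  rewrite /edges run_build_rho sat_fork; apply/orP; right.
  (* The witnesses are the two columns between [3 * x] and [3 * x.+1]. *)
  apply/existsP; exists (node m' (3 * L) a (3 * x).+1).
  apply/existsP; exists (node m' (3 * L) a (3 * x).+2).
  by rewrite !run_build !zigzag_node // /zig; lia.
- by move=> u v /fork_edge [].
Qed.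

Theorem theorem7p1 :
  (exists phi : fo gar,
      wf 2 (rho_formula phi) /\ qf (rho_formula phi) /\
      forall (k : nat) (P : dynprog k), dynprog_wf P -> ~ maintains P phi) /\
  (exists phi : fo gar,
      wf 2 (rho_formula phi) /\ exfo (rho_formula phi) /\
      forall (k : nat) (P : dynprog k), dynprog_wf P -> ~ maintains_acyclic P phi).
Proof.
split.
  exists reversal; split=> //; split=> // k P _; exact: reversal_not_maintained.
exists fork; split=> //; split=> // k P _; exact: fork_not_maintained.
Qed.
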